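(* Let $n\ge 2$ be an integer. The special tridiagonal matrix $R_n$, the basic circulant $\pi_n$ and the basic skew-circulant $\eta_n$ satisfy $$R_n = (\pi_n-\pi_n^T)E_+ + (\eta_n-\eta_n^T)E_-.$$ In other words, for all $x\in\mathbb{C}^n$: if $x$ is even then $R_n x = (\pi_n-\pi_n^T)x$, and if $x$ is odd then $R_n x = (\eta_n-\eta_n^T)x$.
   Context: All matrices are $n\times n$ and are identified with linear maps $\mathbb{C}^n\to\mathbb{C}^n$. $R_n$ is the tridiagonal matrix with every subdiagonal entry equal to $-1$, every superdiagonal entry equal to $1$, $(1,1)$ entry equal to $-1$, $(n,n)$ entry equal to $1$, and zeros elsewhere. The basic circulant $\pi_n=\mathrm{Circ}(0,1,0,\dots,0)$ is the matrix with $1$'s on the superdiagonal, $1$ in the $(n,1)$ entry, and zeros elsewhere. The basic skew-circulant $\eta_n=\mathrm{SCirc}(0,1,0,\dots,0)$ is the matrix with $1$'s on the superdiagonal, $-1$ in the $(n,1)$ entry, and zeros elsewhere. The superscript $T$ denotes transpose. The exchange matrix $E_n$ is defined by $E_n(i,j)=\delta(i+j,n+1)$, where $\delta$ is the Kronecker delta. A vector $x\in\mathbb{C}^n$ is even if $E_n x=x$, and odd if $E_n x=-x$. The linear maps $E_+,E_-:\mathbb{C}^n\to\mathbb{C}^n$ are defined by $E_+x=\tfrac12(x+E_nx)$ and $E_-x=\tfrac12(x-E_nx)$. *)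

(* Defs.v *)
From HB Require Import structures.
From mathcomp Require Import all_boot all_order all_algebra.
Set Implicit Arguments.
Unset Strict Implicit.
Unset Printing Implicit Defensive.
Import GRing.Theory.
Local Open Scope ring_scope.

(* Matrices act on column vectors by [A *m x].  Row and
   column indices in ['I_n] start at 0: the mathematical indices 1 and n are
   the ordinals of value 0 and n - 1. *)

(* For 2 <= n at most one of the first four tests holds at each (i, j). *)
Definition special_tridiag (F : fieldType) (n : nat) : 'M[F]_n :=
  \matrix_(i, j)
    if (j == i.+1 :> nat) then 1
    else if (i == j.+1 :> nat) then -1
    else if (i == 0 :> nat) && (j == 0 :> nat) then -1
    else if (i.+1 == n) && (j.+1 == n) then 1
    else 0.

Definition basic_circulant (F : fieldType) (n : nat) : 'M[F]_n :=
  \matrix_(i, j)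
    if (j == i.+1 :> nat) then 1
    else if (i.+1 == n) && (j == 0 :> nat) then 1
    else 0.

Definition basic_skew_circulant (F : fieldType) (n : nat) : 'M[F]_n :=
  \matrix_(i, j)
    if (j == i.+1 :> nat) then 1
    else if (i.+1 == n) && (j == 0 :> nat) then -1
    else 0.

(* The successors turn 0-based ordinals into 1-based indices. *)
Definition exchange_mx (F : fieldType) (n : nat) : 'M[F]_n :=
  \matrix_(i, j) (i.+1 + j.+1 == n.+1)%N%:R.

Definition even_vec (F : fieldType) (n : nat) (x : 'cV[F]_n) : Prop :=
  exchange_mx F n *m x = x.

Definition odd_vec (F : fieldType) (n : nat) (x : 'cV[F]_n) : Prop :=
  exchange_mx F n *m x = - x.

Definition Eplus (F : fieldType) (n : nat) (x : 'cV[F]_n) : 'cV[F]_n :=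
  2^-1 *: (x + exchange_mx F n *m x).

Definition Eminus (F : fieldType) (n : nat) (x : 'cV[F]_n) : 'cV[F]_n :=
  2^-1 *: (x - exchange_mx F n *m x).

Fact Eplus_is_linear (F : fieldType) (n : nat) : linear (@Eplus F n).
Proof.
move=> a x y; rewrite /Eplus mulmxDr -scalemxAr addrACA -scalerDr.
by rewrite [LHS]scalerDr scalerA [2^-1 * a]mulrC -scalerA.
Qed.

HB.instance Definition _ (F : fieldType) (n : nat) :=
  GRing.isLinear.Build F 'cV[F]_n 'cV[F]_n _ (@Eplus F n)
    (@Eplus_is_linear F n).

Fact Eminus_is_linear (F : fieldType) (n : nat) : linear (@Eminus F n).
Proof.
move=> a x y.
rewrite /Eminus mulmxDr -scalemxAr opprD addrACA -scalerBr.
by rewrite [LHS]scalerDr scalerA [2^-1 * a]mulrC -scalerA.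
Qed.

HB.instance Definition _ (F : fieldType) (n : nat) :=
  GRing.isLinear.Build F 'cV[F]_n 'cV[F]_n _ (@Eminus F n)
    (@Eminus_is_linear F n).

(* Main.v *)
Require Import Defs.
From mathcomp Require Import all_boot all_order all_algebra.
From mathcomp Require Import reals.
From mathcomp Require Import complex.
Import GRing.Theory.
Local Open Scope ring_scope.
Local Open Scope complex_scope.

(** All three matrices share the skew-symmetric tridiagonal part
    [K = U - U^T], where [U] is the nilpotent shift, and differ only in their
    corners.  With [C = e_n e_1^T - e_1 e_n^T] and
    [D = e_n e_n^T - e_1 e_1^T],

      [pi - pi^T = K + C],  [eta - eta^T = K - C],  [R = K + D].

    The exchange matrix [E] swaps [e_1] and [e_n], so [C E = D]
    ([mulmx_corner_exchange]).  Hence [R x = K x + C (E x)], and [E x] is [x]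
    when [x] is even and [- x] when [x] is odd.  The operator identity comes from
    the same formula and the relations [E_+ x + E_- x = x] and
    [E_+ x - E_- x = E x]. *)

Definition shift_mx (F : fieldType) (n : nat) : 'M[F]_n :=
  \matrix_(i, j) (j == i.+1 :> nat)%:R.

Definition skew_shift_mx (F : fieldType) (n : nat) : 'M[F]_n :=
  shift_mx F n - (shift_mx F n)^T.

Definition corner_mx (F : fieldType) (n : nat) : 'M[F]_n.+1 :=
  delta_mx ord_max ord0 - delta_mx ord0 ord_max.

Lemma basic_circulantE (F : fieldType) (n : nat) :
  basic_circulant F n.+1 = shift_mx F n.+1 + delta_mx ord_max ord0.
Proof.
apply/matrixP => i j; rewrite !mxE -!val_eqE /= eqSS.
by case: (nat_of_ord j) => [|k]; rewrite ?andbF /=; case: eqP => _;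
  rewrite ?addr0 ?add0r.
Qed.

Lemma basic_skew_circulantE (F : fieldType) (n : nat) :
  basic_skew_circulant F n.+1 = shift_mx F n.+1 - delta_mx ord_max ord0.
Proof.
apply/matrixP => i j; rewrite !mxE -!val_eqE /= eqSS.
by case: (nat_of_ord j) => [|k]; rewrite ?andbF /=; case: eqP => _;
  rewrite ?subr0 ?sub0r.
Qed.

Lemma circulant_skew_part (F : fieldType) (n : nat) :
  basic_circulant F n.+1 - (basic_circulant F n.+1)^T =
  skew_shift_mx F n.+1 + corner_mx F n.
Proof.
by rewrite basic_circulantE linearD /= trmx_delta opprD addrACA.
Qed.

Lemma skew_circulant_skew_part (F : fieldType) (n : nat) :
  basic_skew_circulant F n.+1 - (basic_skew_circulant F n.+1)^T =
  skew_shift_mx F n.+1 - corner_mx F n.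
Proof.
by rewrite basic_skew_circulantE linearB /= trmx_delta opprD addrACA -opprD.
Qed.

(** For a single row the two diagonal corners would coincide and cancel, whence
    the size at least 2. *)
Lemma special_tridiagE (F : fieldType) (n : nat) :
  special_tridiag F n.+2 =
  skew_shift_mx F n.+2 + (delta_mx ord_max ord_max - delta_mx ord0 ord0).
Proof.
apply/matrixP => i j; rewrite !mxE -!val_eqE /= !eqSS.
case: (eqVneq (j : nat) i.+1) => [->|_].
  rewrite (ltn_eqF (leqnSn i.+1)) andbF.
  have -> : (i == n.+1 :> nat) && (i.+1 == n.+1) = false.
    by apply/andP => -[/eqP -> /eqP/esym/n_Sn].
  by rewrite !subr0 addr0.
case: (eqVneq (i : nat) j.+1) => [->|_].
  have -> : (j.+1 == n.+1) && (j == n.+1 :> nat) = false.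
    by apply/andP => -[/eqP[->] /eqP/n_Sn].
  by rewrite subr0 sub0r addr0.
rewrite subr0 add0r.
case: eqP => [->|_] /=; last by case: ifP; rewrite subr0.
by case: (nat_of_ord j == 0%N); rewrite /= ?subr0 ?sub0r.
Qed.

Lemma mul_delta_exchange (F : fieldType) (m n : nat) (i : 'I_m) (j : 'I_n) :
  delta_mx i j *m exchange_mx F n = delta_mx i (rev_ord j).
Proof.
apply/matrixP => a b; rewrite !mxE (bigD1 j) //= !mxE eqxx andbT.
rewrite big1 => [|k /negPf kj]; last by rewrite !mxE kj andbF mul0r.
rewrite addr0 -natrM mulnb; congr ((_ && _)%:R).
by rewrite -val_eqE /= addnS eqSS -(eqn_add2l j.+1 b) subnKC ?ltn_ord.
Qed.

Lemma mulmx_corner_exchange (F : fieldType) (n : nat) :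
  corner_mx F n *m exchange_mx F n.+1 =
  delta_mx ord_max ord_max - delta_mx ord0 ord0.
Proof.
rewrite mulmxBl !mul_delta_exchange; congr (delta_mx _ _ - delta_mx _ _).
  by apply: val_inj; rewrite /= subn1.
by apply: val_inj; rewrite /= subnn.
Qed.

Lemma special_tridiag_mulmx (F : fieldType) (n : nat) (x : 'cV[F]_n.+2) :
  special_tridiag F n.+2 *m x =
  skew_shift_mx F n.+2 *m x + corner_mx F n.+1 *m (exchange_mx F n.+2 *m x).
Proof. by rewrite special_tridiagE -mulmx_corner_exchange mulmxDl mulmxA. Qed.

Lemma Eplus_add_Eminus (F : fieldType) (n : nat) (x : 'cV[F]_n) :
  2 != 0 :> F -> Eplus x + Eminus x = x.
Proof.
move=> two_neq0; rewrite /Eplus /Eminus -scalerDr addrACA subrr addr0.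
by rewrite -mulr2n -scaler_nat scalerA mulVf ?scale1r.
Qed.

Lemma Eplus_sub_Eminus (F : fieldType) (n : nat) (x : 'cV[F]_n) :
  2 != 0 :> F -> Eplus x - Eminus x = exchange_mx F n *m x.
Proof.
move=> two_neq0; rewrite /Eplus /Eminus -scalerBr opprB addrC addrA subrK.
by rewrite -mulr2n -scaler_nat scalerA mulVf ?scale1r.
Qed.

Theorem proposition2 (R : realType) (n : nat) (hn : (2 <= n)%N) :
  (forall x : 'cV[R[i]]_n,
     special_tridiag R[i] n *m x =
       (basic_circulant R[i] n - (basic_circulant R[i] n)^T) *m Eplus x
       + (basic_skew_circulant R[i] n - (basic_skew_circulant R[i] n)^T)
           *m Eminus x)
  /\ (forall x : 'cV[R[i]]_n,
       (even_vec x ->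
          special_tridiag R[i] n *m x =
            (basic_circulant R[i] n - (basic_circulant R[i] n)^T) *m x)
       /\ (odd_vec x ->
          special_tridiag R[i] n *m x =
            (basic_skew_circulant R[i] n - (basic_skew_circulant R[i] n)^T)
              *m x)).
Proof.
case: n hn => [//|[//|n]] _.
rewrite circulant_skew_part skew_circulant_skew_part.
split=> [x|x]; last first.
  rewrite special_tridiag_mulmx; split=> ->; first by rewrite -mulmxDl.
  by rewrite mulmxN -mulmxBl.
have two_neq0 : 2 != 0 :> R[i] by rewrite Num.Theory.pnatr_eq0.
rewrite special_tridiag_mulmx -Eplus_sub_Eminus //.
rewrite -[X in _ *m X + _](Eplus_add_Eminus _ _ x two_neq0).
by rewrite mulmxDr mulmxBr addrACA -mulmxDl -mulmxBl.
Qed.
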